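(* Let $\mathbb{U}$ be a subfield of $\mathbb{R}$. Then the set of nonzero spectra of positive doubly stochastic matrices over $\mathbb{U}$ (of all sizes) and the set of nonzero spectra of primitive stochastic matrices over $\mathbb{U}$ with positive trace (of all sizes) coincide.
   Context: A matrix is nonnegative (resp. positive) if all its entries are $\ge 0$ (resp. $>0$). A square matrix is stochastic if it is nonnegative and every row sum is $1$; it is doubly stochastic if both it and its transpose are stochastic. A matrix $A$ is primitive if it is nonnegative, square, and there is some $r\in\mathbb{N}$ such that $A^r$ is positive. The nonzero spectrum of a square matrix $A$ is the set of all nonzero eigenvalues of $A$. *)

(* Defs.v *)
From HB Require Import structures.
From mathcomp Require Import all_boot all_order all_algebra.
From mathcomp Require Import classical_sets reals complex.

Set Implicit Arguments.
Unset Strict Implicit.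
Unset Printing Implicit Defensive.

Import Order.TTheory GRing.Theory Num.Theory.

Local Open Scope classical_set_scope.
Local Open Scope ring_scope.

Definition nonnegative_mx (R : numDomainType) m n (A : 'M[R]_(m, n)) : Prop :=
  forall i j, 0 <= A i j.

Definition positive_mx (R : numDomainType) m n (A : 'M[R]_(m, n)) : Prop :=
  forall i j, 0 < A i j.

Definition stochastic (R : numDomainType) n (A : 'M[R]_n) : Prop :=
  nonnegative_mx A /\ forall i, \sum_j A i j = 1.

Definition doubly_stochastic (R : numDomainType) n (A : 'M[R]_n) : Prop :=
  stochastic A /\ stochastic A^T.

Definition primitive_mx (R : numDomainType) n (A : 'M[R]_n) : Prop :=
  nonnegative_mx A /\ exists2 r : nat, (0 < r)%N & positive_mx (A ^+ r).

(* Eigenvalues of a real matrix are complex. They are collected in a set,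
   without multiplicities. *)
Definition nonzero_spectrum (R : rcfType) n (A : 'M[R]_n) : set R[i] :=
  [set z | eigenvalue (map_mx (real_complex R) A) z /\ z != 0].

(* Sizes are of the form n.+1: the empty matrix is vacuously positive and
   doubly stochastic, but its trace is not positive. *)
Definition positive_doubly_stochastic_spectra (R : realType) (U : {pred R}) :
    set (set R[i]) :=
  [set S | exists (n : nat) (A : 'M[R]_n.+1),
     [/\ A \is a mxOver U, positive_mx A, doubly_stochastic A
       & S = nonzero_spectrum A]].

Definition primitive_stochastic_spectra (R : realType) (U : {pred R}) :
    set (set R[i]) :=
  [set S | exists (n : nat) (A : 'M[R]_n.+1),
     [/\ A \is a mxOver U, primitive_mx A, stochastic A, 0 < \tr A
       & S = nonzero_spectrum A]].

(* Main.v *)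
(* A primitive stochastic matrix A with positive trace is turned into a positive
   doubly stochastic matrix by steps that preserve the nonzero spectrum because
   they replace a product M N by N M.

   1. Splitting a state z with a loop creates a state with a loop whose
      successors are the two-step successors of z. Iterating, some row becomes
      positive.
   2. If row z is positive, conjugating A by the stochastic matrix that differs
      from 1 only in row z, where it is (1 - eps) e_z + eps A_z, makes positive
      every row i with A_iz > 0. By irreducibility all rows become positive.
   3. If p is the stationary vector of a positive A and q is a rational
      probability vector close to p, then B = A + 1 (q - q A) is still positive.
      It has stationary vector q, lies over U although p need not, and is
      conjugate to A by 1 + 1 (q - p), where 1 (q - p) is the column of ones
      times a row.
   4. If q_i is proportional to an integer k_i, splitting every state i into
      k_i equal copies makes the stationary vector uniform, that is, the matrix
      doubly stochastic. *)

Require Import Defs.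
From mathcomp Require Import all_boot all_order all_algebra.
From mathcomp Require Import classical_sets reals.
From mathcomp Require Import complex ring lra.

Set Implicit Arguments.
Unset Strict Implicit.
Unset Printing Implicit Defensive.

Import Order.TTheory GRing.Theory Num.Theory.

Local Open Scope ring_scope.

(** * Nonzero spectra of [M N] and [N M] *)

(** If the row [v] is an eigenvector of [M N], then [v M] is one of [N M]. It is nonzero, since
    [v M = 0] would give [a v = 0]. *)
Lemma eigenvalue_mulmxC (F : fieldType) m n (M : 'M[F]_(m, n)) (N : 'M[F]_(n, m))
    (a : F) :
  a != 0 -> eigenvalue (M *m N) a -> eigenvalue (N *m M) a.
Proof.
move=> a0 /eigenvalueP [v vMN v0]; apply/eigenvalueP; exists (v *m M).
  by rewrite !mulmxA -(mulmxA v) vMN -scalemxAl.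
apply: contra v0 => /eqP vM0; move: vMN; rewrite mulmxA vM0 mul0mx.
by move/esym/eqP; rewrite scaler_eq0 (negPf a0).
Qed.

Lemma nonzero_spectrum_mulmxC (R : rcfType) m n (M : 'M[R]_(m, n))
    (N : 'M[R]_(n, m)) :
  nonzero_spectrum (M *m N) = nonzero_spectrum (N *m M).
Proof.
rewrite /nonzero_spectrum !map_mxM.
apply/seteqP; split=> z [ez z0]; split=> //; exact: eigenvalue_mulmxC.
Qed.

Lemma exp_mulmxC (R : pzRingType) m n (M : 'M[R]_(m, n)) (N : 'M[R]_(n, m)) k :
  (M *m N) ^+ k.+1 = M *m (N *m M) ^+ k *m N.
Proof.
elim: k => [|k IHk]; first by rewrite expr0 mulmx1.
by rewrite exprS IHk -mulmxE [in RHS]exprS -mulmxE !mulmxA.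
Qed.

(** * Supports of products, stochastic and primitive matrices *)

Section Nonnegative.
Variable R : numDomainType.

Lemma nonnegative_mulmx m n p (A : 'M[R]_(m, n)) (B : 'M[R]_(n, p)) :
  nonnegative_mx A -> nonnegative_mx B -> nonnegative_mx (A *m B).
Proof.
by move=> A0 B0 i j; rewrite mxE; apply: sumr_ge0 => k _; rewrite mulr_ge0.
Qed.

Lemma nonnegative_exp n (A : 'M[R]_n) k :
  nonnegative_mx A -> nonnegative_mx (A ^+ k).
Proof.
move=> A0; elim: k => [|k IHk]; last by rewrite exprS; apply: nonnegative_mulmx.
by move=> i j; rewrite mxE ler0n.
Qed.

Lemma mulmx_gt0 m n p (A : 'M[R]_(m, n)) (B : 'M[R]_(n, p)) i j k :
  nonnegative_mx A -> nonnegative_mx B -> 0 < A i j -> 0 < B j k ->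
  0 < (A *m B) i k.
Proof.
move=> A0 B0 Aij Bjk; rewrite mxE (bigD1 j) //= ltr_wpDr ?mulr_gt0 //.
by apply: sumr_ge0 => l _; rewrite mulr_ge0.
Qed.

Lemma mulmx_gt0_inv m n p (A : 'M[R]_(m, n)) (B : 'M[R]_(n, p)) i k :
  nonnegative_mx A -> nonnegative_mx B -> 0 < (A *m B) i k ->
  exists2 j, 0 < A i j & 0 < B j k.
Proof.
move=> A0 B0; rewrite mxE lt0r => /andP[/eqP AB0 _].
have [j _|j] := psumr_neq0P _ AB0; first by rewrite mulr_ge0.
by rewrite /= mulr_ge0_gt0 // => /andP[]; exists j.
Qed.

Lemma stochasticE n (A : 'M[R]_n) :
  stochastic A <-> nonnegative_mx A /\ A *m const_mx 1 = const_mx 1 :> 'cV_n.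
Proof.
split=> -[A0 A1]; split=> //.
  by apply/matrixP => i j; rewrite !mxE -[RHS](A1 i); apply: eq_bigr => k _;
     rewrite mxE mulr1.
move=> i; move/matrixP/(_ i 0): A1; rewrite !mxE => <-.
by apply: eq_bigr => k _; rewrite mxE mulr1.
Qed.

Lemma stochastic_le1 n (A : 'M[R]_n) i j : stochastic A -> A i j <= 1.
Proof.
by move=> [A0 A1]; rewrite -(A1 i) (bigD1 j) //= lerDl sumr_ge0.
Qed.

Lemma primitive_col_gt0 n (A : 'M[R]_n) j : primitive_mx A -> exists i, 0 < A i j.
Proof.
move=> [A0 [[//|r] _ Ar]]; move: (Ar j j); rewrite exprSr.
by case/mulmx_gt0_inv => // [|i _ Aij]; [exact: nonnegative_exp | exists i].
Qed.

End Nonnegative.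

(** * Splitting looped states until some row is positive *)

(** The invariant of all later steps: matrices and sizes change while the spectrum [S] stays
    fixed. *)
Definition stochastic_model (R : realType) (U : {pred R}) (S : set R[i])
    n (A : 'M[R]_n.+1) : Prop :=
  [/\ A \is a mxOver U, primitive_mx A, stochastic A & nonzero_spectrum A = S].

(** Factor [A = E D] and take [D E]. The new state [ord0] moves as [z] does in two steps, so its row
    is positive one power earlier. *)
Lemma split_looped_state (R : realType) (U : divringClosed R) S n
    (A : 'M[R]_n.+1) z k :
  stochastic_model U S A -> 0 < A z z -> (forall j, 0 < (A ^+ k.+2) z j) ->
  exists A' : 'M[R]_n.+2, [/\ stochastic_model U S A', 0 < A' ord0 ord0
    & forall j, 0 < (A' ^+ k.+1) ord0 j].
Proof.
move=> [AU Ap As AS] Azz Ak.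
have A0 := Ap.1; have /stochasticE[_ A1] := As.
pose D : 'M[R]_(1 + n.+1, n.+1) := col_mx (row z A) 1%:M.
pose e : 'cV[R]_n.+1 := delta_mx z 0.
(* Row [z] of [E] sends half its mass to the new state and halves the rest; the other rows are those
   of [A]. [D] then moves the new state as [A] moves [z] and fixes the old states. *)
pose E : 'M[R]_(n.+1, 1 + n.+1) :=
  row_mx (2^-1 *: e) (A - 2^-1 *: (e *m row z A)).
have ED : E *m D = A by rewrite mul_row_col mulmx1 -scalemxAl addrC subrK.
have El i : E i (lshift n.+1 0) = 2^-1 * (i == z)%:R.
  by rewrite row_mxEl !mxE eqxx andbT.
have Er i j : E i (rshift 1 j) = A i j * (1 - 2^-1 * (i == z)%:R).
  rewrite row_mxEr !mxE big_ord1 !mxE eqxx andbT; by case: eqVneq => [->|_] /=; ring.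
have Du j : D (lshift n.+1 0) j = A z j by rewrite col_mxEu mxE.
have D0 : nonnegative_mx D.
  move=> i j; case: (@split_ordP 1 n.+1 i) => i' ->.
    by rewrite col_mxEu mxE A0.
  by rewrite col_mxEd mxE ler0n.
have d_gt0 (i : 'I_n.+1) : 0 < 1 - 2^-1 * (i == z)%:R :> R by case: eqP => _ /=; lra.
have E0 : nonnegative_mx E.
  move=> i j; case: (@split_ordP 1 n.+1 j) => j' ->; rewrite ?ord1 ?El ?Er.
    by rewrite mulr_ge0 // ?invr_ge0 ler0n.
  by rewrite mulr_ge0 // ltW.
have D1 : D *m const_mx 1 = const_mx 1 :> 'cV_(1 + n.+1).
  by rewrite mul_col_mx mul1mx -row_mul A1 row_const col_mx_const.
have E1 : E *m const_mx 1 = const_mx 1 :> 'cV_(n.+1).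
  by rewrite -D1 mulmxA ED.
have DE k' : (D *m E) ^+ k'.+1 = D *m A ^+ k' *m E by rewrite exp_mulmxC ED.
have D_row i : exists j, 0 < D i j.
  case: (@split_ordP 1 n.+1 i) => i' ->; first by exists z; rewrite col_mxEu mxE.
  by exists i'; rewrite col_mxEd mxE eqxx ltr01.
have E_col j : exists i, 0 < E i j.
  case: (@split_ordP 1 n.+1 j) => j' ->.
    by exists z; rewrite ord1 El eqxx mulr1 invr_gt0 ltr0n.
  have [i Aij] := primitive_col_gt0 j' Ap.
  by exists i; rewrite Er mulr_gt0.
have half : 2^-1 \in U by rewrite rpredV rpred_nat.
have DU : D \is a mxOver U.
  apply/mxOverP => i j.
  case: (split_ordP i) => i' ->; last by rewrite col_mxEd mxE rpred_nat.
  by rewrite col_mxEu mxE (mxOverP AU).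
have EU : E \is a mxOver U.
  apply/mxOverP => i j; case: (split_ordP j) => j' ->; rewrite ?ord1 ?El ?Er.
    by rewrite rpredM ?rpred_nat.
  by rewrite rpredM ?rpredB ?rpredM ?rpred_nat ?rpred1 // (mxOverP AU).
have o : ord0 = lshift n.+1 0 :> 'I_(1 + n.+1) by exact/val_inj.
exists (D *m E); split; first split.
- exact: mxOverM.
- split; first exact: nonnegative_mulmx.
  case: Ap.2 => r _ Ar; exists r.+1 => // i j; rewrite DE.
  have [i' Di] := D_row i; have [j' Ej] := E_col j.
  have DA0 : nonnegative_mx (D *m A ^+ r).
    by apply: nonnegative_mulmx => //; exact: nonnegative_exp.
  apply: (mulmx_gt0 (j := j')) => //.
  by apply: (mulmx_gt0 (j := i')) => //; exact: nonnegative_exp.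
- apply/stochasticE; split; first exact: nonnegative_mulmx.
  by rewrite -mulmxA E1 D1.
- by rewrite nonzero_spectrum_mulmxC ED.
- rewrite o; apply: (mulmx_gt0 (j := z)) => //; first by rewrite Du.
  by rewrite El eqxx mulr1 invr_gt0 ltr0n.
- move=> j; rewrite DE.
  have -> : (D *m A ^+ k *m E) ord0 j = (A ^+ k.+1 *m E) z j.
    rewrite o mul_col_mx mul_col_mx col_mxEu exprS -mulmxE.
    by rewrite -!row_mul mxE.
  have Ak0 := nonnegative_exp k.+1 A0.
  case: (@split_ordP 1 n.+1 j) => j' ->.
    (* The new state is entered from [z], where the loop allows waiting for any number of steps. *)
    apply: (mulmx_gt0 (j := z)) => //.
      elim: (k.+1) => [|k' IHk]; first by rewrite mxE eqxx ltr01.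
      by rewrite exprS; apply: (mulmx_gt0 (j := z)) => //; exact: nonnegative_exp.
    by rewrite ord1 El eqxx mulr1 invr_gt0 ltr0n.
  (* For an old state, [E] has the support of [A], so it serves as the last step of the walk. *)
  move: (Ak j'); rewrite exprSr => /(mulmx_gt0_inv Ak0 A0)[i Aki Aij].
  by apply: (mulmx_gt0 (j := i)) => //; rewrite Er mulr_gt0.
Qed.

(** Positive trace gives a loop at some [z]. Each split lowers by one the power in which the row of
    the looped state is positive, down to the first power. *)
Lemma exists_full_row (R : realType) (U : divringClosed R) S n
    (A : 'M[R]_n.+1) :
  stochastic_model U S A -> 0 < \tr A ->
  exists m (B : 'M[R]_m.+1) z, stochastic_model U S B /\ forall j, 0 < B z j.
Proof.
move=> AS trA.
have [z Azz] : exists z, 0 < A z z.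
  have [_ [A0 _] _ _] := AS.
  have [i _||z Az] := @psumr_neq0P _ _ xpredT (fun i => A i i); last by exists z.
    exact: A0.
  by apply/eqP; rewrite gt_eqF.
have [_ [_ [[//|r] _ Ar]] _ _] := AS.
move: (Ar z) => {trA Ar}; elim: r n A z AS Azz => [|r IHr] n A z AS Azz Ar.
  by exists n, A, z.
by have [A' [AS' A00 Ar']] := split_looped_state AS Azz Ar; apply: (IHr _ A' ord0).
Qed.

(** * Spreading positivity from one row to all rows *)

Lemma primitive_support (R : numDomainType) n (A B : 'M[R]_n) :
  nonnegative_mx B -> (forall i j, 0 < A i j -> 0 < B i j) ->
  primitive_mx A -> primitive_mx B.
Proof.
move=> B0 AB [A0 [r r0 Ar]]; split=> //; exists r => // i j.
move: (Ar i j) => {Ar r0}; elim: r i j => [|r IHr] i j; first by rewrite !expr0 !mxE.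
rewrite !exprS => /mulmx_gt0_inv[//||l Ail Alj]; first exact: nonnegative_exp.
apply: (mulmx_gt0 (j := l)) => //; [exact: nonnegative_exp | exact: AB | exact: IHr].
Qed.

(** Right multiplication by [E] adds [eps * A i z] times [A_z - e_z] to each row [i], filling it
    when [A i z > 0]. The left factor [F], the inverse of [E], changes only row [z]. *)
Lemma spread_full_row (R : realType) (U : divringClosed R) S n
    (A : 'M[R]_n.+1) z :
  stochastic_model U S A -> (forall j, 0 < A z j) ->
  exists B : 'M[R]_n.+1, [/\ stochastic_model U S B,
    forall i j, 0 < A i j -> 0 < B i j
    & forall i, 0 < A i z -> forall j, 0 < B i j].
Proof.
move=> [AU Ap As AS] Az.
have A0 := Ap.1; have /stochasticE[_ A1] := As.
have [d [d0 dU dA]] : exists d, [/\ 0 < d, d \in U & forall j, d <= A z j].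
  case: (@arg_minP _ _ _ ord0 xpredT (A z) isT) => j _ jmin.
  by exists (A z j); split=> [||j']; rewrite ?(mxOverP AU) ?jmin.
(* Since [d <= 1], row [z] of [A E] is at least [(1 - eps) * 3 * eps >= 2 * eps], while the amount
   subtracted from it in [B_z] is at most [eps]. *)
pose eps := d / 3%:R.
have d1 : d <= 1 := le_trans (dA ord0) (stochastic_le1 _ _ As).
have eps0 : 0 < eps by rewrite divr_gt0 // ltr0n.
have deps : d = 3 * eps by rewrite /eps mulrC divfK // pnatr_eq0.
have epsU : eps \in U by rewrite rpredM ?rpredV ?rpred_nat.
pose e : 'cV[R]_n.+1 := delta_mx z 0.
have [s s_def] : exists s : 'rV[R]_n.+1, s = eps *: (row z A - delta_mx 0 z).
  by eexists.
pose sg := eps * (A z z - 1).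
have sE j : s 0 j = eps * (A z j - (j == z)%:R) by rewrite s_def !mxE.
have Azz1 := stochastic_le1 z z As.
have se : s *m e = sg%:M.
  by apply/matrixP=> i j; rewrite !ord1 -colE !mxE sE eqxx mulr1n.
have sg1 : 0 < 1 + sg by rewrite /sg; have := dA z; nra.
pose E : 'M[R]_n.+1 := 1%:M + e *m s.
(* Inverse of a rank-one perturbation of the identity, with [sg] the scalar [s e]. *)
pose F : 'M[R]_n.+1 := 1%:M - (1 + sg)^-1 *: (e *m s).
have eses : e *m s *m (e *m s) = sg *: (e *m s).
  by rewrite mulmxA -(mulmxA e) se mul_mx_scalar -scalemxAl.
have EF : E *m F = 1%:M.
  rewrite mulmxDl !mul1mx mulmxBr mulmx1 -scalemxAr eses scalerA.
  rewrite -addrA [X in _ + X](_ : _ = 0) ?addr0 //.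
  rewrite -[X in _ + (X - _)]scale1r -scaleNr -scalerBl -scalerDl.
  by rewrite (_ : _ + _ = 0) ?scale0r //; field; rewrite gt_eqF.
have s1 : s *m const_mx 1 = 0 :> 'M_1.
  rewrite s_def -scalemxAl mulmxBl -row_mul A1 row_const.
  by rewrite -rowE row_const subrr scaler0.
have E1 : E *m const_mx 1 = const_mx 1 :> 'cV_n.+1.
  by rewrite mulmxDl mul1mx -mulmxA s1 mulmx0 addr0.
have F1 : F *m const_mx 1 = const_mx 1 :> 'cV_n.+1.
  by rewrite mulmxBl mul1mx -scalemxAl -mulmxA s1 mulmx0 scaler0 subr0.
have esE i j : (e *m s) i j = (i == z)%:R * s 0 j.
  by rewrite mxE big_ord1 !mxE eqxx andbT.
have AE i j : (A *m E) i j = A i j + A i z * s 0 j.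
  by rewrite mulmxDr mulmx1 mulmxA -colE [LHS]mxE; congr (_ + _); rewrite mxE big_ord1 mxE.
(* Only the entry in column [z] can decrease, by at most [eps * A i z]. *)
have AE_ge i j : (1 - eps) * A i j <= (A *m E) i j.
  rewrite AE sE.
  have := mulr_ge0 (mulr_ge0 (ltW eps0) (A0 i z)) (A0 z j).
  have := mulr_ge0 (ltW eps0) (A0 i j).
  by case: eqVneq => [->|_] /=; nra.
have AE0 : nonnegative_mx (A *m E).
  by move=> i j; apply: le_trans (AE_ge i j); rewrite mulr_ge0 //; lra.
have AEs : stochastic (A *m E).
  by apply/stochasticE; split; rewrite // -mulmxA E1.
have AAEs : stochastic (A *m (A *m E)).
  apply/stochasticE; split; first exact: nonnegative_mulmx.
  by rewrite -!mulmxA E1 !A1.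
pose B := F *m (A *m E).
have B_other i j : i != z -> B i j = (A *m E) i j.
  move=> iz; rewrite /B mulmxBl mul1mx -scalemxAl -[in LHS]mulmxA !mxE.
  by rewrite big_ord1 !mxE (negPf iz) mul0r mulr0 subr0.
have B_z j : (1 + sg) * B z j =
    (1 + eps * A z z) * (A *m E) z j - eps * (A *m (A *m E)) z j.
  have -> : B = A *m E - (1 + sg)^-1 *: (e *m (s *m (A *m E))).
    by rewrite /B mulmxBl mul1mx -scalemxAl -mulmxA.
  have -> : s *m (A *m E) = eps *: (row z (A *m (A *m E)) - row z (A *m E)).
    by rewrite s_def -scalemxAl mulmxBl -row_mul -rowE.
  have key (M N : 'M[R]_n.+1) :
      (N - (1 + sg)^-1 *: (e *m (eps *: (row z M - row z N)))) z j =
      N z j - (1 + sg)^-1 * (eps * (M z j - N z j)).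
    by rewrite !mxE big_ord1 !mxE !eqxx mul1r.
  rewrite key mulrBr mulrA divff ?gt_eqF // /sg; ring.
have Bz_gt0 j : 0 < B z j.
  rewrite -(pmulr_rgt0 _ sg1) B_z.
  have AEzj : 2 * eps <= (A *m E) z j.
    apply: le_trans (AE_ge z j); have := dA j; move: d1; rewrite deps => e3 Azj.
    have : (1 - eps) * (3 * eps) <= (1 - eps) * A z j by rewrite ler_wpM2l //; lra.
    by move: eps0; nra.
  have AAEzj := stochastic_le1 z j AAEs.
  have := mulr_ge0 (mulr_ge0 (ltW eps0) (A0 z z)) (AE0 z j).
  have : eps * (A *m (A *m E)) z j <= eps * 1 by rewrite ler_pM2l.
  by lra.
have B0 : nonnegative_mx B.
  move=> i j; have [->|iz] := eqVneq i z; first exact: ltW.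
  by rewrite B_other.
have AB i j : 0 < A i j -> 0 < B i j.
  have [->|iz] := eqVneq i z => // Aij.
  rewrite B_other //; apply: lt_le_trans (AE_ge i j).
  by rewrite mulr_gt0 //; lra.
exists B; split; [split| exact: AB |].
- have esU : e *m s \is a mxOver U.
    apply/mxOverP => i j; rewrite esE sE.
    by rewrite rpredM ?rpred_nat // rpredM // rpredB ?rpred_nat ?(mxOverP AU).
  have oneU : (1%:M : 'M[R]_n.+1) \is a mxOver U by rewrite mxOver_scalar ?rpred0 ?rpred1.
  apply: mxOverM; last by apply: mxOverM => //; rewrite rpredD.
  apply: rpredB => //; apply: mxOverZ => //.
  by rewrite rpredV rpredD ?rpred1 // rpredM // rpredB ?rpred1 // (mxOverP AU).
- exact: (primitive_support B0 AB).
- apply/stochasticE; split=> //.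
  by rewrite -!mulmxA E1 A1 F1.
- by rewrite nonzero_spectrum_mulmxC -mulmxA EF mulmx1.
- move=> i Aiz j; have [->|iz] := eqVneq i z => //.
  rewrite B_other // AE sE.
  have := mulr_gt0 (mulr_gt0 eps0 Aiz) (Az j); have := A0 i j.
  by case: eqVneq => [->|_] /=; nra.
Qed.

(** Induction on the number of rows that are not full. Supports only grow, so full rows stay full,
    and each round fills at least one more. *)
Lemma exists_positive_model (R : realType) (U : divringClosed R) S n
    (A : 'M[R]_n.+1) z :
  stochastic_model U S A -> (forall j, 0 < A z j) ->
  exists B : 'M[R]_n.+1, stochastic_model U S B /\ positive_mx B.
Proof.
pose full (A : 'M[R]_n.+1) i := [forall j, 0 < A i j].
have [k] := ubnP #|[set i | ~~ full A i]|.
elim: k A => // k IHk A Ak AS Az.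
have [Apos|] := boolP [forall i, full A i].
  by exists A; split=> // i j; move/forallP/(_ i)/forallP/(_ j): Apos.
rewrite negb_forall => /existsP[i0 i0full].
have zfull : full A z by apply/forallP.
(* A walk from [i0] to [z] must step somewhere from a row that is not full to a full one. *)
have [i ifull [z' z'full Aiz']] :
    exists2 i, ~~ full A i & exists2 z', full A z' & 0 < A i z'.
  have [_ [A0 [r _ Ar]] _ _] := AS.
  move: (Ar i0 z) => {Ar}; elim: r i0 i0full => [|r IHr] i i_nfull.
    rewrite mxE; case: eqVneq => [iz|_]; last by rewrite ltxx.
    by rewrite iz zfull in i_nfull.
  rewrite exprS => /mulmx_gt0_inv[//||l Ail Alz]; first exact: nonnegative_exp.
  by have [lfull|lfull] := boolP (full A l); [exists i => //; exists l | exact: IHr Alz].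
have [B [BS AB Bz']] := spread_full_row AS (forallP z'full).
apply: (IHk B) => //; last by move=> j; apply: AB.
rewrite ltnS in Ak; apply: leq_trans Ak; apply: proper_card.
apply/properP; split; last first.
  by exists i; rewrite !inE // negbK; apply/forallP; exact: Bz'.
apply/fintype.subsetP => l; rewrite !inE; apply: contra => /forallP lfull.
by apply/forallP => j; apply: AB.
Qed.

(** * Stationary vectors and their rational approximation *)

Lemma positive_primitive (R : numDomainType) n (A : 'M[R]_n) :
  positive_mx A -> primitive_mx A.
Proof. by move=> A0; split; [move=> i j; exact: ltW | exists 1]. Qed.

(** For a real left fixed vector [v], the triangle inequality gives [|v| <= |v| A] entrywise. Both
    sides have the same total because rows of [A] sum to 1, so they are equal; positivity of [A]
    makes [|v|] positive. *)
Lemma exists_stationary (R : realFieldType) n (A : 'M[R]_n.+1) :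
  positive_mx A -> stochastic A ->
  exists p : 'rV[R]_n.+1, [/\ positive_mx p, p *m A = p & \sum_j p 0 j = 1].
Proof.
move=> Apos As; have [A0 Ar] := As; have /stochasticE[_ A1] := As.
have /eigenvalueP[v] : eigenvalue A 1.
  rewrite /eigenvalue /eigenspace kermx_eq0 row_free_unit.
  (* An invertible [A - 1] could not kill the column of ones. *)
  apply/negP => u; have := mulKmx u (const_mx 1 : 'cV_n.+1).
  rewrite mulmxBl A1 mul1mx subrr mulmx0 => /matrixP/(_ 0 0)/eqP.
  by rewrite !mxE eq_sym oner_eq0.
rewrite scale1r => vA v0.
pose q : 'rV[R]_n.+1 := \row_j `|v 0 j|.
have q0 : nonnegative_mx q by move=> i j; rewrite mxE.
have le_qA j : 0 <= (q *m A) 0 j - q 0 j.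
  rewrite subr_ge0 !mxE -{1}vA mxE; apply: le_trans (ler_norm_sum _ _ _) _.
  by apply: ler_sum => i _; rewrite normrM mxE (ger0_norm (A0 i j)).
have qA : q *m A = q.
  apply/rowP => j; apply/eqP; rewrite -subr_eq0; apply/eqP.
  apply: (@psumr_eq0P _ _ xpredT (fun j => (q *m A) 0 j - q 0 j)) => //.
  rewrite sumrB; apply/eqP; rewrite subr_eq0; apply/eqP.
  under eq_bigr do rewrite mxE.
  rewrite exchange_big /=; apply: eq_bigr => i _.
  by rewrite -mulr_sumr Ar mulr1.
have [i0 vi0] : exists i, 0 < q 0 i.
  have /rV0Pn[i vi] := v0.
  by exists i; rewrite mxE normr_gt0.
have qpos j : 0 < q 0 j.
  by rewrite -qA; apply: (mulmx_gt0 (j := i0)).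
have sq : 0 < \sum_j q 0 j.
  by rewrite (bigD1 i0) //= ltr_wpDr // sumr_ge0.
exists ((\sum_j q 0 j)^-1 *: q); split.
- by move=> i j; rewrite ord1 mxE mulr_gt0 ?invr_gt0.
- by rewrite -scalemxAl qA.
- under eq_bigr do rewrite mxE.
  by rewrite -mulr_sumr mulVf // gt_eqF.
Qed.

Lemma exists_rational_stationary (R : realType) (U : divringClosed R) S n
    (A : 'M[R]_n.+1) :
  stochastic_model U S A -> positive_mx A ->
  exists (B : 'M[R]_n.+1) (k : 'I_n.+1 -> nat),
    [/\ stochastic_model U S B, positive_mx B, forall i, (0 < k i)%N
      & \row_i (k i)%:R *m B = \row_i (k i)%:R].
Proof.
move=> [AU Ap As AS] Apos.
have [A0 Ar] := As; have /stochasticE[_ A1] := As.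
have [p [p0 pA p1]] := exists_stationary Apos As.
have [d d0 dA] : exists2 d, 0 < d & forall i j, d <= A i j.
  case: (@arg_minP _ _ _ (ord0, ord0) xpredT (fun ij => A ij.1 ij.2) isT) => ij _ ijmin.
  by exists (A ij.1 ij.2) => // i j; exact: (ijmin (i, j)).
(* Rounding [M p] changes an entry of [u - u A] by at most [n + 1] downwards; after division by
   [N > M] this is below [d], the least entry of [A]. *)
pose M := (Num.truncn (n.+1%:R / d)).+1.
have Md : n.+1%:R < d * M%:R.
  by rewrite mulrC -ltr_pdivrMr //; exact: truncnS_gt.
(* Floor plus one makes every [k i] positive and strictly above [M p_i], whence [N > M]. *)
pose k i := (Num.truncn (M%:R * p 0 i)).+1.
have k_lt i : M%:R * p 0 i < (k i)%:R by exact: truncnS_gt.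
have k_le i : (k i)%:R <= M%:R * p 0 i + 1.
  rewrite /k -natr1 lerD2r.
  by have /truncn_itv/andP[] : 0 <= M%:R * p 0 i by rewrite mulr_ge0 ?ler0n ?ltW.
pose N := (\sum_i k i)%N.
have MN : (M%:R : R) < N%:R.
  have -> : M%:R = \sum_i M%:R * p 0 i by rewrite -mulr_sumr p1 mulr1.
  rewrite natr_sum.
  apply: ltr_sum => [|i _]; last exact: k_lt.
  by apply/hasP; exists ord0; rewrite ?mem_index_enum.
have N0 : (0 : R) < N%:R by apply: le_lt_trans MN; rewrite ler0n.
have [u u_def] : exists u : 'rV[R]_n.+1, u = \row_i (k i)%:R by eexists.
have [q q_def] : exists q : 'rV[R]_n.+1, q = N%:R^-1 *: u by eexists.
have u1 : u *m const_mx 1 = N%:R%:M :> 'M_1.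
  apply/matrixP => i j; rewrite !ord1 !mxE eqxx natr_sum.
  by apply: eq_bigr => l _; rewrite u_def !mxE mulr1.
have q1 : q *m const_mx 1 = 1%:M :> 'M_1.
  by rewrite q_def -scalemxAl u1 scale_scalar_mx mulVf // gt_eqF.
have p1' : p *m const_mx 1 = 1%:M :> 'M_1.
  apply/matrixP => i j; rewrite !ord1 !mxE eqxx -[RHS]p1.
  by apply: eq_bigr => l _; rewrite mxE mulr1.
pose one : 'cV[R]_n.+1 := const_mx 1.
pose B := A + one *m (q - q *m A).
have BE i j : B i j = A i j + (q 0 j - (q *m A) 0 j).
  have key (x y : 'rV[R]_n.+1) :
      (A + one *m (x - y)) i j = A i j + (x 0 j - y 0 j).
    by rewrite !mxE big_ord1 !mxE mul1r.
  exact: key.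
have Bpos : positive_mx B.
  move=> i j; rewrite BE q_def -scalemxAl.
  have key (x y : 'rV[R]_n.+1) : (N%:R^-1 *: x) 0 j - (N%:R^-1 *: y) 0 j
    = N%:R^-1 * (x 0 j - y 0 j) by rewrite !mxE mulrBr.
  rewrite key; have : - n.+1%:R <= u 0 j - (u *m A) 0 j.
    (* [M p] is stationary, so only the rounding error [t] in [0, 1] matters. *)
    pose t := u - M%:R *: p.
    have -> : u 0 j - (u *m A) 0 j = t 0 j - (t *m A) 0 j.
      have -> : t *m A = u *m A - M%:R *: p by rewrite mulmxBl -scalemxAl pA.
      by rewrite /t; move: (u *m A) => uA; rewrite !mxE; ring.
    have t0 i' : 0 <= t 0 i' by rewrite !mxE u_def mxE subr_ge0 ltW.
    have t1 i' : t 0 i' <= 1 by rewrite !mxE u_def mxE lerBlDl.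
    have : (t *m A) 0 j <= n.+1%:R.
      rewrite mxE -[n.+1 in leRHS]card_ord -sumr_const.
      by apply: ler_sum => l _; rewrite mulr_ile1 ?A0 // stochastic_le1.
    by have := t0 j; lra.
  move=> uA; rewrite -(pmulr_rgt0 _ N0) mulrDr mulrA divff ?gt_eqF // mul1r.
  have : N%:R * d <= N%:R * A i j by rewrite ler_pM2l.
  have : d * M%:R < d * N%:R by rewrite ltr_pM2l.
  by move: Md uA; lra.
have [v v_def] : exists v : 'rV[R]_n.+1, v = q - p by eexists.
have v1 : v *m one = 0 by rewrite v_def mulmxBl q1 p1' subrr.
pose E : 'M[R]_n.+1 := 1%:M + one *m v.
(* Since [v] has entry sum 0, [one v] squares to 0, so [F] is the inverse of [E]. *)
pose F : 'M[R]_n.+1 := 1%:M - one *m v.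
have EF : E *m F = 1%:M.
  rewrite mulmxDl mul1mx mulmxBr mulmx1 mulmxA -(mulmxA one v) v1.
  by rewrite mulmx0 mul0mx subr0 subrK.
(* The product is [A + one (v - v A)], and [v - v A = q - q A] because [p A = p]. *)
have BF : B = F *m (A *m E).
  rewrite mulmxDr mulmx1 (mulmxA A) A1 mulmxBl mul1mx mulmxDr.
  rewrite mulmxA -(mulmxA one v one) v1 mulmx0 mul0mx addr0 -mulmxA.
  rewrite /B -addrA -mulmxBr; congr (_ + one *m _).
  by rewrite v_def mulmxBl pA; rewrite opprB addrA subrK.
have qU : q \is a mxOver U.
  apply/mxOverP => i j; rewrite q_def u_def !mxE.
  by rewrite rpredM ?rpredV ?rpred_nat.
exists B, k; split; [split|exact: Bpos|by []|].
- have oneU : one \is a mxOver U by rewrite mxOver_const ?rpred1.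
  by apply: rpredD => //; apply: mxOverM => //; apply: rpredB => //; exact: mxOverM.
- exact: positive_primitive.
- apply/stochasticE; split; first by move=> i j; exact: ltW.
  by rewrite mulmxDl A1 -mulmxA mulmxBl q1 -mulmxA A1 q1 subrr mulmx0 addr0.
- by rewrite BF nonzero_spectrum_mulmxC -mulmxA EF mulmx1.
- rewrite -u_def mulmxDr mulmxA u1 mul_scalar_mx q_def -scalemxAl -scalerBr.
  by rewrite scalerA divff ?gt_eqF // scale1r addrC subrK.
Qed.

(** * Splitting states into equal copies *)

(** Enumerates the disjoint union of the ['I_(k i)]. That [f] has [k i] points over [i] is recorded
    as a rule for sums, the form needed for row and column sums. *)
Lemma sum_over_fibers n (k : 'I_n.+1 -> nat) : (forall i, 0 < k i)%N ->
  exists m (f : 'I_m.+1 -> 'I_n.+1), forall (V : nmodType) (F : 'I_n.+1 -> V),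
    \sum_x F (f x) = \sum_i F i *+ k i.
Proof.
move=> k0; pose T := {i : 'I_n.+1 & 'I_(k i)}.
have [m Tm] : exists m, m.+1 = #|{: T}|.
  exists #|{: T}|.-1; rewrite prednK //; apply/card_gt0P.
  by exists (Tagged (fun i => 'I_(k i)) (Ordinal (k0 ord0))).
exists m, (fun x => tag (enum_val (cast_ord Tm x))) => V F.
rewrite (reindex (fun t : T => cast_ord (esym Tm) (enum_rank t))) /=; last first.
  exists (fun x => enum_val (cast_ord Tm x)) => [t|x] _.
    by rewrite cast_ordKV enum_rankK.
  by rewrite enum_valK cast_ordK.
under eq_bigr do rewrite cast_ordKV enum_rankK.
transitivity (\sum_i \sum_(j < k i) F i); first by rewrite sig_big_dep.
by apply: eq_bigr => i _; rewrite sumr_const card_ord.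
Qed.

(** [D] sends a copy to its state and [E] shares each transition equally among the copies of its
    target. A column of [D E] over [j] sums to [(k B)_j / k_j = 1]. *)
Lemma exists_doubly_stochastic (R : realType) (U : divringClosed R) S n
    (B : 'M[R]_n.+1) (k : 'I_n.+1 -> nat) :
  stochastic_model U S B -> positive_mx B -> (forall i, 0 < k i)%N ->
  \row_i (k i)%:R *m B = \row_i (k i)%:R ->
  exists m (C : 'M[R]_m.+1), [/\ C \is a mxOver U, positive_mx C,
    doubly_stochastic C & S = nonzero_spectrum C].
Proof.
move=> [BU _ [_ B1] BS] Bpos k0 kB.
have [m [f sum_f]] := sum_over_fibers k0.
have kR0 i : (k i)%:R != 0 :> R by rewrite pnatr_eq0 -lt0n.
pose D : 'M[R]_(m.+1, n.+1) := \matrix_(x, j) (f x == j)%:R.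
pose E : 'M[R]_(n.+1, m.+1) := \matrix_(i, y) (B i (f y) / (k (f y))%:R).
have ED : E *m D = B.
  apply/matrixP => i j; rewrite mxE.
  under eq_bigr do rewrite !mxE.
  rewrite (sum_f _ (fun l => B i l / (k l)%:R * (l == j)%:R)) (bigD1 j) //=.
  rewrite big1 ?addr0 => [|l /negPf ->]; last by rewrite mulr0 mul0rn.
  by rewrite eqxx mulr1 -[LHS]mulr_natr divfK.
have DE x y : (D *m E) x y = B (f x) (f y) / (k (f y))%:R.
  rewrite mxE (bigD1 (f x)) //= !mxE eqxx mul1r big1 ?addr0 // => j jx.
  by rewrite !mxE eq_sym (negPf jx) mul0r.
have DEpos : positive_mx (D *m E) by move=> x y; rewrite DE divr_gt0 // ltr0n.
exists m, (D *m E); split=> //.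
- by apply/mxOverP => x y; rewrite DE rpredM ?rpredV ?rpred_nat // (mxOverP BU).
- split; split; [by move=> x y; exact: ltW| |by move=> x y; rewrite mxE ltW|].
    move=> x; under eq_bigr do rewrite DE.
    rewrite (sum_f _ (fun l => B (f x) l / (k l)%:R)) -[RHS](B1 (f x)).
    by apply: eq_bigr => l _; rewrite -[LHS]mulr_natr divfK.
  move=> y; under eq_bigr do rewrite mxE DE.
  rewrite (sum_f _ (fun l => B l (f y) / (k (f y))%:R)).
  move/matrixP/(_ 0 (f y)): kB; rewrite !mxE => kB.
  apply: (mulIf (kR0 (f y))); rewrite mul1r mulr_suml -[RHS]kB.
  by apply: eq_bigr => l _; rewrite mxE -[X in X * _]mulr_natl -mulrA divfK.
- by rewrite nonzero_spectrum_mulmxC ED.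
Qed.

(** * Equality of the two sets of spectra *)

Theorem corollary4p4 (R : realType) (U : divringClosed R) :
  positive_doubly_stochastic_spectra U = primitive_stochastic_spectra U.
Proof.
apply/seteqP; split=> S [n [A]].
  (* The easy inclusion keeps the same matrix; its diagonal is positive, hence so is its trace. *)
  move=> [AU Apos [As _] ->]; exists n, A; split=> //; first exact: positive_primitive.
  by rewrite /mxtrace big_ord_recl ltr_wpDr // sumr_ge0 // => i _; exact: ltW.
move=> [AU Ap As trA AS].
have [|n1 [A1 [z [A1S A1z]]]] := @exists_full_row _ U S _ A _ trA; first by split.
have [A2 [A2S A2pos]] := exists_positive_model A1S A1z.
have [B [k [BS Bpos k0 kB]]] := exists_rational_stationary A2S A2pos.
exact: exists_doubly_stochastic BS Bpos k0 kB.
Qed.
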